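(* Let $P$ be a discrete poset which is strongly connected. Then the antichain cutsets of $P$ are exactly the level sets of $P$.
   Context: A maximal chain of a poset is a chain not properly contained in any other chain. An antichain cutset of $P$ is a set of elements intersecting each maximal chain of $P$ in exactly one element. $P$ is strongly connected if for any two maximal chains $\mathbf{c},\mathbf{d}$ there is a finite sequence of maximal chains $\mathbf{c}=\mathbf{c}^{(0)},\dots,\mathbf{c}^{(n)}=\mathbf{d}$ with consecutive chains having symmetric difference of cardinality two. $P$ is discrete if every interval $[a,b]$ of $P$ has a maximal chain of finite length. For a totally ordered set $R$, an $R$-grading of $P$ is a map $\rho:P\to R$ whose restriction to each maximal chain of $P$ is an order isomorphism onto $R$; the level sets of $P$ are the nonempty sets $L_r=\{x\in P:\rho(x)=r\}$, $r\in R$ (such a poset as in the claim admits an $R$-grading for some $R\subseteq\mathbb{Z}$, and level sets refer to such a grading). *)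

(* Defs.v *)
From mathcomp Require Import all_boot all_order all_algebra.
From mathcomp Require Import all_classical.

Set Implicit Arguments.
Unset Strict Implicit.
Unset Printing Implicit Defensive.

Import Order.TTheory.

Local Open Scope card_scope.
Local Open Scope order_scope.
Local Open Scope classical_set_scope.

Section Posets.
Context {d : Order.disp_t} {P : porderType d}.
Implicit Types A C L : set P.

(* Maximality among the chains of the subposet A; with A = setT these are the
   maximal chains of P.  The empty set counts as a chain. *)
Definition chain_in A C : Prop := C `<=` A /\ total_on C <=%O.

Definition maximal_chain_in A C : Prop :=
  chain_in A C /\ forall D, chain_in A D -> C `<=` D -> D = C.

Definition maximal_chain C : Prop := maximal_chain_in [set: P] C.

Definition antichain_cutset A : Prop :=
  forall C, maximal_chain C -> exists x, A `&` C = [set x].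

(* R is a totally ordered set given as a subset of an orderType T, so that
   subsets of the integers are covered directly. *)
Definition grading d' (T : orderType d') (R : set T) (rho : P -> T) : Prop :=
  (forall x, R (rho x)) /\
  forall C, maximal_chain C ->
    set_bij C R rho /\
    (forall x y, C x -> C y -> (rho x <= rho y) = (x <= y)).

Definition level_set d' (T : orderType d') (R : set T) (rho : P -> T) L : Prop :=
  L !=set0 /\ exists2 r, R r & L = [set x | rho x = r].

End Posets.

Definition strongly_connected d (P : porderType d) : Prop :=
  forall C D : set P, maximal_chain C -> maximal_chain D ->
  exists (n : nat) (c : nat -> set P),
    [/\ c 0%N = C, c n = D,
        forall i, (i <= n)%N -> maximal_chain (c i) &
        forall i, (i < n)%N -> c i `+` c i.+1 #= `I_2].

Definition discrete_poset d (P : porderType d) : Prop :=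
  forall a b : P, a <= b ->
  exists C : set P,
    maximal_chain_in [set x | a <= x <= b] C /\ finite_set C.

(* Main.v *)
Require Import Defs.
From mathcomp Require Import all_boot all_order all_algebra.
From mathcomp Require Import all_classical.

(** Strong connectivity reduces statements about two maximal chains to the case
    where D = (C \ {c}) U {e}.  In that case any grading gives c and e the same
    value, so the point where a cutset meets a maximal chain has a constant
    grade; this shows that a cutset is a level set.

    For the existence of a grading, connectivity makes any two maximal chains
    differ by finitely many elements, equally many on each side, and with
    discreteness their bounded parts are finite.  Fix a maximal chain C0 and x0
    in C0, and let rho x be the signed number of elements by which the part of
    a maximal chain D below x exceeds the part of C0 below x0.  Splicing two
    maximal chains at a common element x shows that D does not matter, rho
    is clearly strictly increasing on D, and its image is unchanged when c is
    swapped for e, since c and e have the same elements below them. *)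

Set Implicit Arguments.
Unset Strict Implicit.
Unset Printing Implicit Defensive.

Import Order.TTheory GRing.Theory Num.Theory.

Local Open Scope card_scope.
Local Open Scope order_scope.
Local Open Scope classical_set_scope.

(** * Signed counting of set differences *)

Section Excess.
Local Open Scope ring_scope.
Context {T : choiceType}.
Implicit Types X Y Z S : set T.

(* [#|X `\` Y| - #|Y `\` X|] when both are finite, and [0] otherwise. *)
Definition excess X Y : int :=
  \sum_(i \in [set: T]) ((i \in X)%:R - (i \in Y)%:R : int).

(** Summands vanish off the symmetric difference, so any superset of it may serve as the index set,
    even when infinite. *)
Lemma excessE S X Y : X `+` Y `<=` S ->
  excess X Y = \sum_(i \in S) ((i \in X)%:R - (i \in Y)%:R : int).
Proof.
move=> XYS; apply/esym/fsbig_widen => // i [_ NSi] /=.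
have [iX|iX] := boolP (i \in X); have [iY|iY] := boolP (i \in Y);
  rewrite ?subrr //; exfalso; apply: NSi; apply: XYS.
- by left; split; [rewrite inE in iX | rewrite notin_setE in iY].
- by right; split; [rewrite inE in iY | rewrite notin_setE in iX].
Qed.

(** The summands telescope. Finiteness guards against the default value [0] of an infinite sum. *)
Lemma excess_trans Y X Z : finite_set (X `+` Y) -> finite_set (Y `+` Z) ->
  excess X Z = excess X Y + excess Y Z.
Proof.
move=> fXY fYZ; set S := (X `+` Y) `|` (Y `+` Z).
rewrite !(@excessE S); [|by move=> i; right|by move=> i; left|].
  rewrite -fsbig_split; last by rewrite finite_setU.
  by apply: eq_fsbigr => i _; rewrite /= addrA subrK.
move=> i [[Xi Zi]|[Zi Xi]]; have [Yi|Yi] := pselect (Y i).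
- by right; left.
- by left; left.
- by left; right.
- by right; right.
Qed.

Lemma excess_gt0 X Y x : Y `<=` X -> finite_set (X `\` Y) ->
  X x -> ~ Y x -> 0 < excess X Y.
Proof.
move=> YX fXY Xx Yx.
rewrite (@excessE (X `\` Y)); last by move=> i [//|[/YX]].
rewrite (fsbigD1 x)//= mem_set// memNset// subr0.
apply: ltr_pwDl => //; apply: fsumr_ge0 => i [[Xi Yi] _].
by rewrite mem_set// memNset.
Qed.

Lemma excess_swap X Y x y : X `\` Y = [set x] -> Y `\` X = [set y] ->
  excess X Y = 0.
Proof.
move=> XY YX.
have [Xx nYx] : (X `\` Y) x by rewrite XY.
have [Yy nXy] : (Y `\` X) y by rewrite YX.
rewrite (@excessE (X `+` Y))// /setY XY YX fsbigU0; last 3 first.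
- exact: finite_set1.
- exact: finite_set1.
- by move=> i [/= -> xy]; apply: nXy; rewrite -xy.
by rewrite !fsbig_set1 (mem_set Xx) (mem_set Yy) (memNset nYx) (memNset nXy).
Qed.

Lemma eq_excess X Y X' Y' : X `\` Y = X' `\` Y' -> Y `\` X = Y' `\` X' ->
  excess X Y = excess X' Y'.
Proof.
move=> eXY eYX; rewrite (@excessE (X `+` Y))// (@excessE (X `+` Y)); last first.
  by rewrite /setY eXY eYX.
apply: eq_fsbigr => i; rewrite inE => -[XY|YX].
  have [X'i Y'i] : (X' `\` Y') i by rewrite -eXY.
  by case: XY => Xi Yi; rewrite (mem_set Xi) (mem_set X'i) (memNset Yi)
    (memNset Y'i).
have [Y'i X'i] : (Y' `\` X') i by rewrite -eYX.
by case: YX => Yi Xi; rewrite (mem_set Yi) (mem_set Y'i) (memNset Xi)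
  (memNset X'i).
Qed.

End Excess.

Lemma card_eq_I2 (T : Type) (A : set T) : A #= `I_2 ->
  exists a b, [/\ A a, A b, a <> b & forall z, A z -> z = a \/ z = b].
Proof.
move=> /card_set_bijP[f [fA finj fsurj]].
have [a Aa fa] := fsurj 0%N isT; have [b Ab fb] := fsurj 1%N isT.
exists a, b; split=> //; first by move=> ab; rewrite ab fb in fa.
move=> z Az; have := fA z Az => /=; case fz: (f z) => [|[|]]// _.
- by left; apply: finj; rewrite ?inE// fz fa.
- by right; apply: finj; rewrite ?inE// fz fb.
Qed.

(** * Maximal chains: extension, exchange, splicing *)

Section Chains.
Context {d : Order.disp_t} {P : porderType d}.
Implicit Types (A C D E S : set P) (a b c e x y z : P).

Lemma total_on_comparable C x y : total_on C <=%O -> C x -> C y -> x >=< y.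
Proof. by move=> tC Cx Cy; apply/orP; exact: tC. Qed.

Lemma maximal_chain_total C : maximal_chain C -> total_on C <=%O.
Proof. by case=> -[]. Qed.

Lemma maximal_chain_comparable C x y :
  maximal_chain C -> C x -> C y -> x >=< y.
Proof. by move=> /maximal_chain_total; exact: total_on_comparable. Qed.

Lemma maximal_chain_mem C x :
  maximal_chain C -> (forall z, C z -> x >=< z) -> C x.
Proof.
move=> [[_ tC] maxC] xC; rewrite -(maxC (x |` C)); [by left| |by move=> z; right].
split=> // s t [->|Cs] [->|Ct].
- by left.
- by apply/orP; exact: xC.
- by rewrite orC; apply/orP; exact: xC.
- exact: tC.
Qed.

Lemma maximal_chainP C : total_on C <=%O ->
  (forall x, (forall z, C z -> x >=< z) -> C x) -> maximal_chain C.
Proof.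
move=> tC maxC; split=> // D [_ tD] CD; apply/seteqP; split=> // x Dx.
by apply: maxC => z /CD Dz; exact: total_on_comparable Dx Dz.
Qed.

Lemma maximal_chain_subset C D :
  maximal_chain C -> maximal_chain D -> C `<=` D -> C = D.
Proof. by move=> [_ maxC] [chD _] CD; rewrite (maxC D). Qed.

Lemma extend_chain S : total_on S <=%O ->
  exists2 C, maximal_chain C & S `<=` C.
Proof.
(* Adjoining [S] inside [Q], rather than requiring [S] to lie in [X], lets the union of an empty
   family satisfy [Q] as well. *)
move=> tS; pose Q := [set X : set P | total_on (X `|` S) <=%O].
have [F FQ tF|M [QM maxM]] := @Zorn_bigcup _ Q.
  move=> s t [[X FX Xs]|Ss] [[Y FY Yt]|St].
  - have [XY|YX] := tF _ _ FX FY.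
      by apply: (FQ _ FY); left => //; exact: XY.
    by apply: (FQ _ FX); left => //; exact: YX.
  - by apply: (FQ _ FX); [left|right].
  - by apply: (FQ _ FY); [right|left].
  - exact: tS.
exists (M `|` S); last by move=> z; right.
split=> // D [_ tD] MSD; apply/seteqP; split=> // x Dx; left.
apply: contrapT => Mx; apply: (maxM D).
  by split; [move=> z Mz; apply: MSD; left | move=> /(_ x Dx)].
have -> // : Q D = total_on D <=%O.
by rewrite /Q /= setUidl// => z Sz; apply: MSD; right.
Qed.

Lemma mem_maximal_chain x : exists2 C, maximal_chain C & C x.
Proof.
have [|C mC xC] := @extend_chain [set x]; first by move=> s t -> ->; left.
by exists C => //; exact: xC.
Qed.

(** Neither of two distinct maximal chains contains the other, so the two differing elements lie on
    opposite sides. *)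
Lemma maximal_chain_swap C D : maximal_chain C -> maximal_chain D ->
  C `+` D #= `I_2 -> exists c e, C `\` D = [set c] /\ D `\` C = [set e].
Proof.
move=> mC mD /card_eq_I2[a [b [CDa _ ab CDab]]].
have nCD : C <> D by move=> CD; move: CDa; rewrite CD setYK.
have [c [Cc nDc]] : C `&` ~` D !=set0.
  by apply: nonsubset => /(maximal_chain_subset mC mD).
have [e [De nCe]] : D `&` ~` C !=set0.
  by apply: nonsubset => /(maximal_chain_subset mD mC)/esym.
have CDce z : (C `+` D) z -> z = c \/ z = e.
  have : c <> e by move=> ce; apply: nCe; rewrite -ce.
  have := CDab c (or_introl (conj Cc nDc)).
  have := CDab e (or_intror (conj De nCe)).
  by move=> [->|->] [->|->]// _ /CDab[->|->]; [right|left|left|right].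
exists c, e; split; apply/seteqP; split=> z.
- by move=> /[dup] -[Cz _] CDz; have [|->|ze] := CDce z; [left| |case: nCe; rewrite -ze].
- by move=> /= ->.
- by move=> /[dup] -[Dz _] CDz; have [|zc|->] := CDce z; [right|case: nDc; rewrite -zc|].
- by move=> /= ->.
Qed.

(* [e] is incomparable to [c], by maximality, so it takes the place of [c]. *)
Lemma swap_below_subset C D c e :
  maximal_chain C -> maximal_chain D -> C `\` D = [set c] -> D `\` C = [set e] ->
  C `&` [set z | z < c] `<=` D `&` [set z | z < e].
Proof.
move=> mC mD CD DC z [Cz /= zc].
have [Cc nDc] : (C `\` D) c by rewrite CD.
have [De nCe] : (D `\` C) e by rewrite DC.
have Dz : D z.
  by apply: contrapT => nDz; have : (C `\` D) z by []; rewrite CD => /= zE;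
    move: zc; rewrite zE ltxx.
split=> //=.
have /orP[ze|ez] := maximal_chain_comparable mD Dz De.
  by rewrite lt_neqAle ze andbT; apply/eqP => zE; apply: nCe; rewrite -zE.
case: nCe; apply: (maximal_chain_mem mC) => y Cy.
have [Dy|nDy] := pselect (D y); first exact: maximal_chain_comparable mD De Dy.
have : (C `\` D) y by [].
by rewrite CD => /= ->; rewrite /Order.comparable (le_trans ez (ltW zc)).
Qed.

Lemma swap_below C D c e :
  maximal_chain C -> maximal_chain D -> C `\` D = [set c] -> D `\` C = [set e] ->
  C `&` [set z | z < c] = D `&` [set z | z < e].
Proof. by move=> *; apply/seteqP; split; exact: swap_below_subset. Qed.

(** An element comparable to the whole splice is comparable to [x]. If it is below [x], it is below
    all of [C] from [x] upwards, hence comparable to all of [C] and a member of it. Above [x] the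
    same holds with [D]. *)
Lemma splice_maximal_chain C D x :
  maximal_chain C -> maximal_chain D -> C x -> D x ->
  maximal_chain (C `&` [set z | z < x] `|` D `&` [set z | x <= z]).
Proof.
move=> mC mD Cx Dx; apply: maximal_chainP.
  move=> s t [[Cs /= sx]|[Ds /= xs]] [[Ct /= tx]|[Dt /= xt]].
  - exact: maximal_chain_total mC _ _ Cs Ct.
  - by left; exact: le_trans (ltW sx) xt.
  - by right; exact: le_trans (ltW tx) xs.
  - exact: maximal_chain_total mD _ _ Ds Dt.
move=> z zF.
have /orP[zx|xz] : z >=< x by apply: zF; right; split=> /=.
- have [->|nzx] := eqVneq z x; first by right; split=> /=.
  left; split; last by rewrite /= lt_neqAle nzx.
  apply: (maximal_chain_mem mC) => y Cy.
  have /orP[yx|xy] := maximal_chain_comparable mC Cy Cx; last first.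
    by rewrite /Order.comparable (le_trans zx xy).
  have [->|nyx] := eqVneq y x; first by rewrite /Order.comparable zx.
  by apply: zF; left; split=> //=; rewrite lt_neqAle nyx.
- right; split=> //; apply: (maximal_chain_mem mD) => y Dy.
  have /orP[yx|xy] := maximal_chain_comparable mD Dy Dx; last first.
    by apply: zF; right.
  by rewrite /Order.comparable (le_trans yx xz) orbT.
Qed.

(** * Consequences of strong connectivity *)

Section StronglyConnected.
Hypothesis Pconn : strongly_connected P.

Lemma strongly_connected_ind (Q : set P -> set P -> Prop) :
  (forall C, maximal_chain C -> Q C C) ->
  (forall C D E, maximal_chain D -> Q C D -> Q D E -> Q C E) ->
  (forall C D c e, maximal_chain C -> maximal_chain D ->
     C `\` D = [set c] -> D `\` C = [set e] -> Q C D) ->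
  forall C D, maximal_chain C -> maximal_chain D -> Q C D.
Proof.
move=> Qrefl Qtrans Qswap C D mC mD.
have [n [f [f0 fn fmax fI2]]] := Pconn mC mD.
suff fQ i : (i <= n)%N -> Q C (f i) by rewrite -fn; exact: fQ.
elim: i => [|i IHi] ilt; first by rewrite f0; exact: Qrefl.
have mi := fmax _ (ltnW ilt); apply: (Qtrans _ _ _ mi (IHi (ltnW ilt))).
have mSi := fmax _ ilt.
have [c [e [ce ec]]] := maximal_chain_swap mi mSi (fI2 _ ilt).
exact: Qswap ce ec.
Qed.

Lemma maximal_chains_excess C D : maximal_chain C -> maximal_chain D ->
  finite_set (C `+` D) /\ excess C D = 0%R.
Proof.
move: C D; apply: strongly_connected_ind =>
  [C _|C D E _ [fCD eCD] [fDE eDE]|C D c e _ _ CD DC].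
- by split; [rewrite setYK|rewrite /excess fsbig1// => i _; rewrite subrr].
- split; last by rewrite (excess_trans fCD fDE) eCD eDE addr0.
  (* The two copies of [D] cancel. *)
  have -> : C `+` E = (C `+` D) `+` (D `+` E).
    by rewrite setYA -(setYA C) setYK setY0.
  by apply: (@sub_finite_set _ _ ((C `+` D) `|` (D `+` E)));
    [move=> z [[]|[]]; [left|right]|rewrite finite_setU].
- by split; [rewrite /setY CD DC finite_setU; split|exact: excess_swap CD DC].
Qed.

(** The splice of [C] below [x] with [D] from [x] upwards differs from [D] exactly as the two lower
    parts differ, and two maximal chains have excess zero. *)
Lemma excess_below_eq0 C D x : maximal_chain C -> maximal_chain D ->
  C x -> D x -> excess (C `&` [set z | z < x]) (D `&` [set z | z < x]) = 0%R.
Proof.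
move=> mC mD Cx Dx.
have mF := splice_maximal_chain mC mD Cx Dx.
rewrite -(proj2 (maximal_chains_excess mF mD)).
apply: eq_excess; apply/seteqP; split=> z /=.
- by move=> [[Cz zx] nDz]; split; [left|move=> Dz; apply: nDz].
- by move=> [[[Cz zx]|[]]]// nDz; split=> // -[].
- move=> [[Dz zx] nCz]; split=> // -[[Cz _]|[_ xz]]; first by apply: nCz.
  by move: (lt_le_trans zx xz); rewrite ltxx.
- move=> [Dz nF]; have /orP[zx|xz] := maximal_chain_comparable mD Dz Dx.
    have [zE|nzx] := eqVneq z x.
      by case: nF; right; rewrite zE; split.
    have zlt : z < x by rewrite lt_neqAle nzx.
    by split=> // -[Cz _]; apply: nF; left.
  by case: nF; right.
Qed.

Lemma antichain_cutset_level_set d' (T : orderType d') (R : set T)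
    (rho : P -> T) A :
  grading R rho -> antichain_cutset A <-> level_set R rho A.
Proof.
move=> [rhoR rhoC]; split=> [cutA|[_ [r Rr ->]] C mC]; last first.
  have [[_ rinj rsurj] _] := rhoC C mC.
  have [x Cx xr] := rsurj r Rr; exists x; apply/seteqP; split=> z /=.
    by move=> [zr Cz]; apply: rinj; rewrite ?inE// zr.
  by move=> ->.
pose Q C D := forall x y, A x -> C x -> A y -> D y -> rho x = rho y.
have cut1 C x y : maximal_chain C -> A x -> C x -> A y -> C y -> x = y.
  move=> mC Ax Cx Ay Cy; have [z ACz] := cutA C mC.
  have : (A `&` C) x by [].
  have : (A `&` C) y by [].
  by rewrite ACz => /= -> ->.
have QCD : forall C D, maximal_chain C -> maximal_chain D -> Q C D.
  apply: strongly_connected_ind.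
  - by move=> C mC x y *; congr rho; exact: (@cut1 C).
  - move=> C D E mD CD DE x y Ax Cx Ay Ey.
    have [z AD] := cutA D mD; have [Az Dz] : (A `&` D) z by rewrite AD.
    by rewrite (CD x z)// (DE z y).
  - move=> C D c e mC mD CDE DCE x y Ax Cx Ay Dy.
    have [Dx|nDx] := pselect (D x); first by congr rho; exact: (@cut1 D).
    have [Cy|nCy] := pselect (C y); first by congr rho; exact: (@cut1 C).
    have xc : x = c by have : (C `\` D) x by []; rewrite CDE.
    have ye : y = e by have : (D `\` C) y by []; rewrite DCE.
    have [[_ Dinj Dsurj] _] := rhoC D mD.
    have [[_ Cinj _] _] := rhoC C mC.
    (* The element [z] of [D] with the grade of [x] cannot lie in [C]: injectivity on [C] would give
       [z = x], which is not in [D]. Hence [z] is [e]. *)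
    have [z Dz zx] := Dsurj (rho x) (rhoR x).
    have [Cz|nCz] := pselect (C z).
      have xz : x = z by apply: Cinj; rewrite ?inE.
      by case: nDx; rewrite xz.
    have : (D `\` C) z by [].
    by rewrite DCE => /= ze; rewrite -zx ze ye.
(* Some maximal chain always exists, possibly empty; the cutset meets it, which yields the point [a]
   fixing the level. *)
have [|C mC _] := @extend_chain set0; first by move=> s t [].
have [a ACa] := cutA C mC; have [Aa Ca] : (A `&` C) a by rewrite ACa.
split; first by exists a.
exists (rho a) => //; apply/seteqP; split=> x /=.
  by move=> Ax; have [D mD Dx] := mem_maximal_chain x; exact: (QCD D C).
move=> xa; have [D mD Dx] := mem_maximal_chain x.
have [y AD] := cutA D mD; have [Ay Dy] : (A `&` D) y by rewrite AD.
have [[_ Dinj _] _] := rhoC D mD.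
suff -> : x = y by [].
by apply: Dinj; rewrite ?inE// xa; exact: (QCD C D).
Qed.

(** * Finiteness from discreteness, and the integer grading *)

Section Discrete.
Hypothesis Pdiscr : discrete_poset P.

(** Discreteness gives one finite maximal chain of the interval. It is the trace of a maximal chain
    [E] of the poset, and [C] differs from [E] in finitely many elements. *)
Lemma finite_chain_interval C a b : maximal_chain C ->
  finite_set (C `&` [set z | a <= z <= b]).
Proof.
move=> mC; have [ab|nab] := boolP (a <= b); last first.
  apply: sub_finite_set (@finite_set0 P) => z [_ /= /andP[az zb]].
  by rewrite (le_trans az zb) in nab.
have [C0 [[[C0ab tC0] maxC0] fC0]] := Pdiscr ab.
have [E mE C0E] := extend_chain tC0.
have EC0 : E `&` [set z | a <= z <= b] = C0.
  apply: maxC0; last by move=> z C0z; split; [exact: C0E|exact: C0ab].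
  split; first by move=> z [].
  by move=> s t [Es _] [Et _]; exact: maximal_chain_total mE _ _ Es Et.
apply: (@sub_finite_set _ _ (C0 `|` (C `+` E))); last first.
  by rewrite finite_setU; split=> //; exact: (maximal_chains_excess mC mE).1.
move=> z [Cz zab]; have [Ez|nEz] := pselect (E z).
  by left; rewrite -EC0.
by right; left.
Qed.

(** An element of the difference that belongs to both [C] and [D] must lie between [x] and [y], in
    one order or the other. *)
Lemma finite_below_setY C D x y :
  maximal_chain C -> maximal_chain D -> C x -> D y ->
  finite_set ((C `&` [set z | z < x]) `+` (D `&` [set z | z < y])).
Proof.
move=> mC mD Cx Dy.
apply: (@sub_finite_set _ _ ((C `+` D) `|`
   ((D `&` [set z | y <= z <= x]) `|` (C `&` [set z | x <= z <= y])))).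
  move=> z [[[Cz /= zx] nDz]|[[Dz /= zy] nCz]].
  - have [Dz|] := pselect (D z); last by left; left.
    right; left; split=> //=; rewrite (ltW zx) andbT.
    have /orP[zy|//] := maximal_chain_comparable mD Dz Dy.
    have [->|nzy] := eqVneq z y => //.
    by case: nDz; split=> //; rewrite lt_neqAle nzy.
  - have [Cz|] := pselect (C z); last by left; right.
    right; right; split=> //=; rewrite (ltW zy) andbT.
    have /orP[zx|//] := maximal_chain_comparable mC Cz Cx.
    have [->|nzx] := eqVneq z x => //.
    by case: nCz; split=> //; rewrite lt_neqAle nzx.
rewrite finite_setU; split; first exact: (maximal_chains_excess mC mD).1.
by rewrite finite_setU; split; exact: finite_chain_interval.
Qed.

Lemma exists_grading : exists (R : set int) (rho : P -> int), grading R rho.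
Proof.
have [[x0]|nP] := pselect (inhabited P); last first.
  (* An empty poset is graded by the empty set. *)
  exists set0, (fun=> 0%R); split=> [x|C _]; first by case: nP.
  by do !split=> //; [move=> x|move=> x|move=> x]; case: nP.
have [f fP] : {f : P -> set P & forall x, maximal_chain (f x) /\ f x x}.
  apply: (@choice _ _ (fun x C => maximal_chain C /\ C x)) => x.
  by have [C] := mem_maximal_chain x; exists C.
pose rho x := excess (f x `&` [set z | z < x]) (f x0 `&` [set z | z < x0]).
(* Any maximal chain through [x] computes the same value as the chosen [f x]. *)
have rhoE C x : maximal_chain C -> C x ->
    rho x = excess (C `&` [set z | z < x]) (f x0 `&` [set z | z < x0]).
  move=> mC Cx; have [mx xx] := fP x; have [m0 x00] := fP x0.
  rewrite (@excess_trans _ (f x `&` [set z | z < x])).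
  - by rewrite excess_below_eq0// add0r.
  - exact: finite_below_setY.
  - exact: finite_below_setY.
have rho_lt C x y : maximal_chain C -> C x -> C y -> x < y -> (rho x < rho y)%R.
  move=> mC Cx Cy xy; have [m0 x00] := fP x0.
  (* Passing through the part of [C] below [x] leaves its excess from the part below [y], which is
     positive because [x] itself is counted. *)
  rewrite (rhoE C x)// (rhoE C y)// (@excess_trans _ (C `&` [set z | z < x])
    (C `&` [set z | z < y])); [|exact: finite_below_setY..].
  rewrite ltrDr; apply: (@excess_gt0 _ _ _ x) => //.
  - by move=> z [Cz /= zx]; split=> //; exact: lt_trans zx xy.
  - by have := finite_below_setY mC mC Cy Cx; rewrite /setY finite_setU => -[].
  - by move=> [_ /=]; rewrite ltxx.
have rho_le C x y : maximal_chain C -> C x -> C y -> (rho x <= rho y)%R = (x <= y).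
  move=> mC Cx Cy; have /orP[xy|yx] := maximal_chain_comparable mC Cx Cy.
    rewrite xy; move: xy; rewrite le_eqVlt => /orP[/eqP->|xy]; first by rewrite lexx.
    by rewrite ltW// (rho_lt C).
  move: yx; rewrite le_eqVlt => /orP[/eqP->|yx]; first by rewrite !lexx.
  by rewrite (lt_geF yx); apply/negbTE; rewrite -ltNge (rho_lt C).
have rho_img C D : maximal_chain C -> maximal_chain D -> rho @` C `<=` rho @` D.
  move: C D; apply: strongly_connected_ind =>
    [C _ //|C D E _|C D c e mC mD CDE DCE]; first exact: subset_trans.
  move=> _ [x Cx <-]; have [Dx|nDx] := pselect (D x); first by exists x.
  have xc : x = c by have : (C `\` D) x by []; rewrite CDE.
  have [De _] : (D `\` C) e by rewrite DCE.
  exists e => //.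
  by rewrite (rhoE D)// (rhoE C x)// xc (swap_below mC mD CDE DCE).
(* All maximal chains have the same image by [rho_img], and they cover the poset, so each is mapped
   onto the whole range. *)
exists (range rho), rho; split=> [x|C mC]; first by exists x.
split; last by move=> x y; exact: rho_le.
split.
- by move=> x _; exists x.
- move=> x y; rewrite !inE => Cx Cy xy; apply: le_anti.
  by rewrite -!(rho_le C)// xy lexx.
- move=> _ [x _ <-]; have [D mD Dx] := mem_maximal_chain x.
  by apply: (rho_img D C) => //; exists x.
Qed.

End Discrete.
End StronglyConnected.
End Chains.

Theorem theorem1p2 (d : Order.disp_t) (P : porderType d)
    (Pdiscr : discrete_poset P) (Pconn : strongly_connected P) :
  (exists (R : set int) (rho : P -> int), grading R rho) /\
  (forall (R : set int) (rho : P -> int), grading R rho ->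
     forall A : set P, antichain_cutset A <-> level_set R rho A).
Proof.
split; first exact: exists_grading.
by move=> R rho grR A; exact: antichain_cutset_level_set.
Qed.
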